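(* Let $n\ge 2$ and $A=(a_{ij})\in M_n(\mathbb{H})$. Then all the left eigenvalues of $A$ are located in the union of the $\frac{n(n-1)}{2}$ ovals of Cassini $$F_{ij}(A):=\{z\in\mathbb{H}: |z-a_{ii}|\,|z-a_{jj}|\le c_i(A)\,c_j(A)\},\qquad 1\le i,j\le n,\ i\ne j;$$ that is, $\Lambda_l(A)\subseteq F(A):=\bigcup_{i,j=1,\,i\ne j}^n F_{ij}(A)$.
   Context: $\mathbb{H}$ is the skew field of real quaternions with its usual modulus $|\cdot|$, and $M_n(\mathbb{H})$ is the set of $n\times n$ quaternionic matrices. A quaternion $\lambda$ is a left eigenvalue of $A$ if $Ax=\lambda x$ for some nonzero column vector $x\in\mathbb{H}^n$; $\Lambda_l(A)$ is the set of left eigenvalues. $c_i(A):=\sum_{j\neq i}|a_{ji}|$ is the $i$-th deleted absolute column sum. *)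

(* Defs.v *)
From HB Require Import structures.
From mathcomp Require Import all_boot all_order all_algebra.
From mathcomp Require Import ring lra.
From mathcomp Require Import mathcomp_extra boolp classical_sets reals.

Set Implicit Arguments.
Unset Strict Implicit.
Unset Printing Implicit Defensive.

Import Order.TTheory GRing.Theory Num.Theory.

Local Open Scope ring_scope.
Local Open Scope classical_set_scope.

(* [Quat a b c d] is a + b i + c j + d k. *)
Record quaternion (R : Type) : Type :=
  Quat { quat_re : R; quat_i : R; quat_j : R; quat_k : R }.

Section QuaternionEqChoice.
Variable R : Type.

Definition seq_of_quat (x : quaternion R) : seq R :=
  let: Quat a b c d := x in [:: a; b; c; d].

Definition quat_of_seq (s : seq R) : option (quaternion R) :=
  if s is [:: a; b; c; d] then Some (Quat a b c d) else None.

Lemma seq_of_quatK : pcancel seq_of_quat quat_of_seq.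
Proof. by case. Qed.

End QuaternionEqChoice.

HB.instance Definition _ (R : eqType) := Equality.copy (quaternion R)
  (pcan_type (@seq_of_quatK R)).
HB.instance Definition _ (R : choiceType) := Choice.copy (quaternion R)
  (pcan_type (@seq_of_quatK R)).

Section QuaternionZmodule.
Variable R : zmodType.
Implicit Types x y z : quaternion R.

Definition addq x y : quaternion R :=
  let: Quat a b c d := x in let: Quat a' b' c' d' := y in
  Quat (a + a') (b + b') (c + c') (d + d').

Definition oppq x : quaternion R :=
  let: Quat a b c d := x in Quat (- a) (- b) (- c) (- d).

Lemma addqA : associative addq.
Proof. by move=> [? ? ? ?] [? ? ? ?] [? ? ? ?] /=; rewrite !addrA. Qed.

Lemma addqC : commutative addq.
Proof. by move=> [? ? ? ?] [? ? ? ?] /=; congr Quat; rewrite addrC. Qed.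

Lemma add0q : left_id (Quat 0 0 0 0) addq.
Proof. by move=> [? ? ? ?] /=; rewrite !add0r. Qed.

Lemma addNq : left_inverse (Quat 0 0 0 0) oppq addq.
Proof. by move=> [? ? ? ?] /=; rewrite !addNr. Qed.

HB.instance Definition _ :=
  GRing.isZmodule.Build (quaternion R) addqA addqC add0q addNq.

End QuaternionZmodule.

Section QuaternionRing.
Variable R : comNzRingType.
Implicit Types x y z : quaternion R.

Definition mulq x y : quaternion R :=
  let: Quat a b c d := x in let: Quat a' b' c' d' := y in
  Quat (a * a' - b * b' - c * c' - d * d')
       (a * b' + b * a' + c * d' - d * c')
       (a * c' - b * d' + c * a' + d * b')
       (a * d' + b * c' - c * b' + d * a').

Lemma mulqA : associative mulq.
Proof. by move=> [? ? ? ?] [? ? ? ?] [? ? ? ?] /=; congr Quat; ring. Qed.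

Lemma mul1q : left_id (Quat 1 0 0 0) mulq.
Proof. by move=> [? ? ? ?] /=; congr Quat; ring. Qed.

Lemma mulq1 : right_id (Quat 1 0 0 0) mulq.
Proof. by move=> [? ? ? ?] /=; congr Quat; ring. Qed.

Lemma mulqDl : left_distributive mulq (@addq R).
Proof. by move=> [? ? ? ?] [? ? ? ?] [? ? ? ?] /=; congr Quat; ring. Qed.

Lemma mulqDr : right_distributive mulq (@addq R).
Proof. by move=> [? ? ? ?] [? ? ? ?] [? ? ? ?] /=; congr Quat; ring. Qed.

Lemma oneq_neq0 : Quat 1 0 0 0 != 0 :> quaternion R.
Proof. by apply/eqP => -[] /eqP; rewrite oner_eq0. Qed.

HB.instance Definition _ := GRing.Zmodule_isNzRing.Build (quaternion R)
  mulqA mul1q mulq1 mulqDl mulqDr oneq_neq0.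

End QuaternionRing.

Section QuaternionSkewField.
Variable R : realFieldType.
Implicit Types x y : quaternion R.

Definition sqnormq x : R :=
  let: Quat a b c d := x in a ^+ 2 + b ^+ 2 + c ^+ 2 + d ^+ 2.

Definition conjq x : quaternion R :=
  let: Quat a b c d := x in Quat a (- b) (- c) (- d).

Definition invq x : quaternion R :=
  let: Quat a b c d := conjq x in
  let m := sqnormq x in Quat (a / m) (b / m) (c / m) (d / m).

Lemma sqnormq_ge0 x : 0 <= sqnormq x.
Proof. by case: x => a b c d /=; rewrite !addr_ge0 ?sqr_ge0. Qed.

Lemma sqnormq_eq0 x : (sqnormq x == 0) = (x == 0).
Proof.
apply/eqP/eqP => [|->]; last by rewrite /= !expr0n /= !addr0.
case: x => a b c d /= /eqP.
rewrite !paddr_eq0 ?addr_ge0 ?sqr_ge0 // !sqrf_eq0.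
by move=> /andP[/andP[/andP[/eqP-> /eqP->] /eqP->] /eqP->].
Qed.

Lemma mulVq : {in [pred x | x != 0], left_inverse 1 invq *%R}.
Proof.
move=> x; rewrite inE -sqnormq_eq0; case: x => a b c d /= nz.
by rewrite {1}/GRing.mul /= /GRing.one /=; congr Quat; field.
Qed.

Lemma mulqV : {in [pred x | x != 0], right_inverse 1 invq *%R}.
Proof.
move=> x; rewrite inE -sqnormq_eq0; case: x => a b c d /= nz.
by rewrite {1}/GRing.mul /= /GRing.one /=; congr Quat; field.
Qed.

Lemma unitqP x y : y * x = 1 /\ x * y = 1 -> x \in [pred x | x != 0].
Proof.
case=> _ xy1; rewrite inE; apply/eqP => x0.
by move/eqP: xy1; rewrite x0 mul0r eq_sym oner_eq0.
Qed.

Lemma invq_out : {in [predC [pred x | x != 0]], invq =1 id}.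
Proof.
move=> x; rewrite !inE negbK => /eqP->.
by rewrite -[0]/(Quat 0 0 0 0 : quaternion R) /invq /= oppr0 !mul0r.
Qed.

HB.instance Definition _ := GRing.NzRing_hasMulInverse.Build (quaternion R)
  mulVq mulqV unitqP invq_out.

End QuaternionSkewField.

Section QuaternionNorm.
Variable R : rcfType.
Implicit Types x y : quaternion R.

Definition normq x : R := Num.sqrt (sqnormq x).

Lemma normqD x y : normq (x + y) <= normq x + normq y.
Proof.
rewrite -[leRHS]ger0_norm ?addr_ge0 ?sqrtr_ge0 // -sqrtr_sqr ler_wsqrtr //.
rewrite sqrrD !sqr_sqrtr ?sqnormq_ge0 // -sqrtrM ?sqnormq_ge0 //.
case: x y => [a b c d] [a' b' c' d'] /=.
set p := (X in Num.sqrt X).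
have : a * a' + b * b' + c * c' + d * d' <= Num.sqrt p.
  apply: (le_trans (ler_norm _)); rewrite -sqrtr_sqr ler_wsqrtr //.
  rewrite /p -subr_ge0.
  have -> : (a ^+ 2 + b ^+ 2 + c ^+ 2 + d ^+ 2)
      * (a' ^+ 2 + b' ^+ 2 + c' ^+ 2 + d' ^+ 2)
      - (a * a' + b * b' + c * c' + d * d') ^+ 2
    = (a * b' - b * a') ^+ 2 + (a * c' - c * a') ^+ 2 + (a * d' - d * a') ^+ 2
      + (b * c' - c * b') ^+ 2 + (b * d' - d * b') ^+ 2
      + (c * d' - d * c') ^+ 2 by ring.
  by rewrite !addr_ge0 ?sqr_ge0.
lra.
Qed.

Lemma normq_eq0 x : normq x = 0 -> x = 0.
Proof.
move=> /eqP; rewrite sqrtr_eq0 le_eqVlt ltNge sqnormq_ge0 orbF.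
by rewrite sqnormq_eq0 => /eqP.
Qed.

Lemma normqN x : normq (- x) = normq x.
Proof. by case: x => a b c d; rewrite /normq /= !sqrrN. Qed.

Lemma normqMn x m : normq (x *+ m) = normq x *+ m.
Proof.
have -> : x *+ m = Quat (quat_re x *+ m) (quat_i x *+ m)
                        (quat_j x *+ m) (quat_k x *+ m).
  by elim: m => [|m IH]; rewrite ?mulr0n // !mulrS IH; case: x {IH}.
case: x => a b c d; rewrite /normq /= !exprMn_n -!mulrnDl.
by rewrite -mulr_natr sqrtrM ?addr_ge0 ?sqr_ge0 // natrX sqrtr_sqr normr_nat mulr_natr.
Qed.

HB.instance Definition _ := Num.Zmodule_isNormed.Build R (quaternion R)
  normqD normq_eq0 normqMn normqN.

End QuaternionNorm.

Section LeftSpectrum.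
Variables (R : realType) (n : nat).
Implicit Types A : 'M[quaternion R]_n.

(* [l *: x] multiplies the entries of [x] by [l] on the left. *)
Definition left_eigenvalue A (l : quaternion R) : Prop :=
  exists2 x : 'cV[quaternion R]_n, x != 0 & A *m x = l *: x.

Definition left_spectrum A : set (quaternion R) :=
  [set l | left_eigenvalue A l].

Definition deleted_col_sum A (i : 'I_n) : R :=
  \sum_(j < n | j != i) `|A j i|.

Definition cassini_oval A (i j : 'I_n) : set (quaternion R) :=
  [set z | `|z - A i i| * `|z - A j j|
           <= deleted_col_sum A i * deleted_col_sum A j].

Definition cassini_region A : set (quaternion R) :=
  \bigcup_(p in [set p : 'I_n * 'I_n | p.1 != p.2]) cassini_oval A p.1 p.2.

End LeftSpectrum.

(* Main.v *)
Require Import Defs.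
From mathcomp Require Import all_boot all_order all_algebra.
From mathcomp Require Import classical_sets reals.
From mathcomp Require Import ring boolp.

(** If [l] is a left eigenvalue of [A] then [B := A - l%:M] kills a nonzero
    column [x], so it suffices to show that [B] has trivial right kernel as
    soon as [c_i c_j < |b_ii| |b_jj|] for all [i != j], where [c_i] is the
    [i]-th deleted column sum ([cassini_kernel_trivial]).

    The classical route, comparing the two largest entries of a row vector [y]
    with [y B = 0], needs the equality of row and column rank over a skew
    field.  The argument below stays with [x].  Since the modulus is
    multiplicative, row [i] of [B x = 0] gives the real inequality
    [|b_ii| |x_i| <= \sum_(j != i) |b_ij| |x_j|].  Combining these with
    nonnegative weights [w_i] that make [B] weakly column dominant forces
    [x_j = 0] at every column [j] where the dominance is strict
    ([weighted_column_dominance]).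

    If all columns are strictly dominant, [w = 1] works.  Otherwise
    [|b_pp| <= c_p] for some [p]; the weights [w_p = c_p] and [w_j = |b_pp|]
    for [j != p] give equality at [p] and, by the Cassini inequalities for
    the pairs [(p, j)], strict dominance elsewhere.  Hence only [x_p] can
    survive, and row [p] kills it because [b_pp != 0]. *)

Import Order.TTheory GRing.Theory Num.Theory.

Local Open Scope ring_scope.
Local Open Scope classical_set_scope.

(** Euler's four-square identity. *)
Lemma sqnormqM {R : realFieldType} (x y : quaternion R) :
  sqnormq (x * y) = sqnormq x * sqnormq y.
Proof.
case: x y => [a b c d] [a' b' c' d'].
rewrite [_ * _ in LHS]/GRing.mul /=; ring.
Qed.

Lemma quat_normM {R : rcfType} (x y : quaternion R) : `|x * y| = `|x| * `|y|.
Proof.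
rewrite -[LHS]/(Num.sqrt (sqnormq (x * y))) sqnormqM.
by rewrite sqrtrM ?sqnormq_ge0.
Qed.

Lemma kernel_row_split {T : nzRingType} {n : nat} {B : 'M[T]_n} {x : 'cV[T]_n}
    (Bx0 : B *m x = 0) (i : 'I_n) :
  B i i * x i 0 = - \sum_(j < n | j != i) B i j * x j 0.
Proof.
have /matrixP/(_ i 0) := Bx0; rewrite !mxE (bigD1 i) //= => /eqP.
by rewrite addr_eq0 => /eqP.
Qed.

Lemma kernel_row_le {R : rcfType} {n : nat} {B : 'M[quaternion R]_n}
    {x : 'cV[quaternion R]_n} (Bx0 : B *m x = 0) (i : 'I_n) :
  `|B i i| * `|x i 0| <= \sum_(j < n | j != i) `|B i j| * `|x j 0|.
Proof.
rewrite -quat_normM (kernel_row_split Bx0) normrN.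
apply: le_trans (ler_norm_sum _ _ _) _.
by apply: ler_sum => j _; rewrite quat_normM.
Qed.

(** Weighting the row inequalities [kernel_row_le] by [w], summing them and
    exchanging the sums yields
    [\sum_j (w_j |b_jj| - \sum_(i != j) w_i |b_ij|) |x_j| <= 0]; under weak
    dominance every term is nonnegative, hence zero. *)
Lemma weighted_column_dominance {R : rcfType} {n : nat}
    {B : 'M[quaternion R]_n} {x : 'cV[quaternion R]_n} {w : 'I_n -> R}
    (w_ge0 : forall i, 0 <= w i)
    (dom : forall j, \sum_(i < n | i != j) w i * `|B i j| <= w j * `|B j j|)
    (Bx0 : B *m x = 0) (j : 'I_n) :
  \sum_(i < n | i != j) w i * `|B i j| < w j * `|B j j| -> x j 0 = 0.
Proof.
move=> sdom.
pose gap k := w k * `|B k k| - \sum_(i < n | i != k) w i * `|B i k|.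
have term_ge0 k : true -> 0 <= gap k * `|x k 0|.
  by move=> _; rewrite mulr_ge0 ?normr_ge0 // subr_ge0.
have sum_le0 : \sum_k gap k * `|x k 0| <= 0.
  under eq_bigr do rewrite mulrBl mulr_suml.
  rewrite sumrB subr_le0 (exchange_big_dep predT) //=.
  apply: ler_sum => i _; rewrite -mulrA.
  apply: le_trans (ler_wpM2l (w_ge0 i) (kernel_row_le Bx0 i)) _.
  rewrite mulr_sumr (eq_bigl (fun k => i != k)) => [|k]; last first.
    by rewrite eq_sym.
  by apply: ler_sum => k _; rewrite mulrA.
have /eqP : \sum_k gap k * `|x k 0| = 0.
  by apply/le_anti; rewrite sum_le0 sumr_ge0.
rewrite psumr_eq0 // => /allP/(_ j (mem_index_enum j))/=.
by rewrite mulf_eq0 subr_eq0 gt_eqF //= normr_eq0 => /eqP.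
Qed.

(** The nonsingularity criterion equivalent to the localisation of the left
    spectrum by Cassini ovals. *)
Lemma cassini_kernel_trivial {R : realType} {n : nat} (hn : (2 <= n)%N)
    {B : 'M[quaternion R]_n} {x : 'cV[quaternion R]_n}
    (cassini : forall i j, i != j ->
       deleted_col_sum B i * deleted_col_sum B j < `|B i i| * `|B j j|) :
  B *m x = 0 -> x = 0.
Proof.
move=> Bx0; set c := deleted_col_sum B in cassini.
have c_ge0 i : 0 <= c i by apply: sumr_ge0.
suff x0 : forall i, x i 0 = 0 by apply/matrixP => i k; rewrite ord1 mxE x0.
have [/forallP dom|] := boolP [forall i, c i < `|B i i|].
  have dom1 k : \sum_(l < n | l != k) 1 * `|B l k| < 1 * `|B k k|.
    by under eq_bigr do rewrite mul1r; rewrite mul1r; exact: dom.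
  move=> i; apply: (weighted_column_dominance (w := fun=> 1)) (dom1 i) => // k.
  exact/ltW/dom1.
rewrite negb_forall => /existsP[p]; rewrite -leNgt => dp_le_cp.
(* A second index exists as [n >= 2]; its Cassini inequality with [p] makes
   the diagonal entry at [p] nonzero. *)
have [q qNp] : exists q : 'I_n, p != q.
  have /card_gt1P[a [b [_ _ aNb]]] : (1 < #|'I_n|)%N by rewrite card_ord.
  by have [->|pNa] := eqVneq p a; [exists b | exists a].
have dp_neq0 : `|B p p| != 0.
  apply/eqP => dp0; have := cassini p q qNp.
  by rewrite dp0 mul0r ltNge mulr_ge0.
pose w i := if i == p then c p else `|B p p|.
have w_ge0 i : 0 <= w i by rewrite /w; case: ifP.
have dom_p : \sum_(i < n | i != p) w i * `|B i p| = w p * `|B p p|.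
  rewrite /w eqxx mulrC mulr_sumr.
  by apply: eq_bigr => i /negPf ->.
(* Every weight is at most [c p], so the weighted column sum is at most
   [c p * c j], which is below [|b_pp| |b_jj|]. *)
have dom_strict j : j != p ->
    \sum_(i < n | i != j) w i * `|B i j| < w j * `|B j j|.
  move=> jNp; rewrite [w j]/w (negPf jNp).
  apply: le_lt_trans (cassini p j _); last by rewrite eq_sym.
  rewrite mulr_sumr; apply: ler_sum => i _.
  by rewrite ler_wpM2r // /w; case: ifP.
have dom j : \sum_(i < n | i != j) w i * `|B i j| <= w j * `|B j j|.
  by have [->|/dom_strict/ltW //] := eqVneq j p; rewrite dom_p.
have x0 j : j != p -> x j 0 = 0.
  by move/dom_strict; exact: weighted_column_dominance.
move=> i; have [->|/x0 //] := eqVneq i p.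
have := kernel_row_split Bx0 p.
rewrite big1 => [|j /x0->]; last by rewrite mulr0.
move=> /(congr1 (fun z => `|z|))/eqP; rewrite oppr0 normr0 quat_normM.
by rewrite mulf_eq0 (negPf dp_neq0) normr_eq0 => /eqP.
Qed.

Theorem theorem3p7 (R : realType) (n : nat) (hn : (2 <= n)%N)
    (A : 'M[quaternion R]_n) :
  left_spectrum A `<=` cassini_region A.
Proof.
move=> l [x x_neq0 Ax].
apply: contrapT => l_out; move/eqP: x_neq0; apply.
pose B := A - l%:M.
have Bdiag i : `|B i i| = `|l - A i i| by rewrite !mxE eqxx distrC.
have Bcol i : deleted_col_sum B i = deleted_col_sum A i.
  by apply: eq_bigr => j /negPf jNi; rewrite !mxE jNi subr0.
apply: (cassini_kernel_trivial hn (B := B)) => [i j iNj|].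
  rewrite !Bdiag !Bcol ltNge; apply/negP => l_in.
  by apply: l_out; exists (i, j).
by rewrite mulmxBl mul_scalar_mx Ax subrr.
Qed.
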